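(* If $T$ is a tree with $n$ vertices whose edges are colored with $\ell\geq 2$ colors, then $\operatorname{wld}(T)=n-1$.
   Context: An edge-colored graph $(G,\gamma)$ is a finite connected graph $G$ with a surjective function $\gamma:E(G)\to\mathcal{C}=\{c_1,\dots,c_\ell\}$ onto a finite set of colors (not necessarily a proper edge-coloring). For each color $c_i$ let $E_i(G)=\{e\in E(G):\gamma(e)=c_i\}$. For $W\subseteq E(G)$, let $G_i^W$ be the graph with vertex set $V(G)$ and edge set $W\cup E_i(G)$. The set $W$ is color-connecting if $G_i^W$ is connected for every color $c_i\in\mathcal{C}$. The wild number $\operatorname{wld}(G)$ is the minimum size of a color-connecting set. *)

(* Defs.v *)
From mathcomp Require Import all_boot.
Set Implicit Arguments.
Unset Strict Implicit.
Unset Printing Implicit Defensive.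

(* Graphs are finite and simple. *)
Record sgraph := SGraph {
  vertex :> finType;
  adj : rel vertex;
  adj_sym : symmetric adj;
  adj_irr : irreflexive adj }.

Definition edge_set (G : sgraph) : {set {set G}} :=
  [set [set p.1; p.2] | p : G * G & adj p.1 p.2].

Definition edge (G : sgraph) : finType := {A : {set G} | A \in edge_set G}.

(* The null graph is not counted as connected. *)
Definition connected (G : sgraph) : bool :=
  (0 < #|G|) && [forall x : G, forall y : G, connect (@adj G) x y].

(* [ucycle] also accepts an edge traversed back and forth, [:: x; y], and
   [:: ]; hence the length condition. *)
Definition acyclic (G : sgraph) : Prop :=
  forall s : seq G, ucycle (@adj G) s -> size s < 3.

Definition is_tree (G : sgraph) : Prop := connected G /\ acyclic G.

Section SpanningSubgraph.
Variables (G : sgraph) (F : {set edge G}).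

Definition span_adj : rel G :=
  [rel x y | [exists e in F, sval e == [set x; y]]].

Lemma span_adj_sym : symmetric span_adj.
Proof. by move=> x y /=; apply: eq_existsb => e; rewrite setUC. Qed.

Lemma edge_setE (x y : G) : ([set x; y] \in edge_set G) = adj x y.
Proof.
apply/imsetP/idP => [[[u v]]|xy]; last by exists (x, y); rewrite ?inE.
rewrite inE /= => uv E.
have nuv : u != v by apply: contraTneq uv => ->; rewrite adj_irr.
have := set21 u v; have := set22 u v; rewrite -E !inE.
by case/orP=> /eqP vE; case/orP=> /eqP uE; move: uv nuv;
  rewrite vE uE ?eqxx // adj_sym.
Qed.

Lemma span_adj_irr : irreflexive span_adj.
Proof.
move=> x; apply/negbTE/negP => /existsP[[A AG] /andP[_ /= /eqP AE]].
by move: AG; rewrite AE edge_setE adj_irr.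
Qed.

Definition spanning_subgraph : sgraph := SGraph span_adj_sym span_adj_irr.

End SpanningSubgraph.

Record ecgraph := ECGraph {
  underlying :> sgraph;
  underlying_connected : connected underlying;
  color : finType;
  edge_color : edge underlying -> color;
  edge_color_surj : forall c : color, exists e, edge_color e = c }.

Definition color_class (G : ecgraph) (c : color G) : {set edge G} :=
  [set e | edge_color e == c].

Definition color_connecting (G : ecgraph) (W : {set edge G}) : bool :=
  [forall c : color G, connected (spanning_subgraph (W :|: color_class c))].

(* The default value [setT] of the argmin is color-connecting because G is
   connected, so this is a genuine minimum; see [wldP]. *)
Definition wld (G : ecgraph) : nat :=
  #|[arg min_(W < [set: edge G] | color_connecting W) #|W| ]|.

Lemma color_connectingT (G : ecgraph) : color_connecting [set: edge G].
Proof.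
apply/forallP => c; have /andP[n0 /forallP Gc] := underlying_connected G.
apply/andP; split=> //; apply/forallP => x; apply/forallP => y.
have /forallP/(_ y) := Gc x; congr is_true; apply: eq_connect.
move=> {}x {}y /=; apply/idP/existsP => [xy|[[A AG] /andP[_]]].
  have xyG : [set x; y] \in edge_set G by rewrite edge_setE.
  by exists (Sub [set x; y] xyG); rewrite !inE /=.
by move=> /= /eqP AE; rewrite -edge_setE -AE.
Qed.

Lemma wldP (G : ecgraph) :
  (exists2 W : {set edge G}, color_connecting W & #|W| = wld G) /\
  (forall W : {set edge G}, color_connecting W -> wld G <= #|W|).
Proof.
rewrite /wld; case: arg_minnP => [|W ccW minW]; first exact: color_connectingT.
by split; first exists W.
Qed.

(* Main.v *)
Require Import Defs.
From mathcomp Require Import all_boot.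

(** In a tree every edge is a bridge, so no proper set of edges spans a
    connected subgraph. If [W] is color-connecting, then [W] together with any
    one color class is therefore the whole edge set; applying this to two
    distinct colors shows that every edge lies in [W]. That a tree has [n - 1]
    edges follows from the same fact: joining each vertex other than a root to
    a neighbor nearer to the root gives [n - 1] distinct edges that span a
    connected subgraph. *)

Lemma span_adjW (G : sgraph) (F : {set edge G}) : subrel (span_adj F) (@adj G).
Proof.
move=> x y /existsP[[A AG] /andP[_ /= /eqP AE]].
by rewrite -edge_setE -AE.
Qed.

Lemma edgeP (G : sgraph) (e : edge G) :
  exists x y : G, adj x y /\ sval e = [set x; y].
Proof.
case: e => A AG; have /imsetP[[x y]] := AG.
by rewrite inE /= => xy AE; exists x, y.
Qed.

(** A duplicate-free path in [F] between the ends of an edge [e] closes up through [e] to a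
    [ucycle], so it has at most two vertices; hence it is [e] itself, and [e] lies in [F]. *)
Lemma acyclic_connected_spanT (G : sgraph) (F : {set edge G}) :
  acyclic G -> connected (spanning_subgraph F) -> F = [set: edge G].
Proof.
move=> acG /andP[_ /forallP Fc]; apply/setP => e; rewrite inE.
have [x [y [xy eE]]] := edgeP _ e.
have /forallP/(_ y)/connectP[p] := Fc x.
case/shortenP=> q qP qU _ yE.
have := acG (x :: q); rewrite /ucycle qU andbT /= rcons_path.
rewrite (sub_path (span_adjW _ F) qP) /= -yE adj_sym xy => /(_ isT).
case: q {qU} qP yE => [|z [|//]] /=.
  by move=> _ yx; rewrite yx adj_irr in xy.
rewrite andbT => /existsP[f /andP[fF /eqP fE]] yz _.
by rewrite (_ : e = f) //; apply: val_inj; rewrite /= eE fE yz.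
Qed.

(** Take for [d] the distance from [r]: the last vertex before [x] on a shortest walk from [r] is
    nearer to [r]. *)
Lemma connected_rank (G : sgraph) (r : G) : connected G ->
  exists d : G -> nat, forall x, x != r -> exists2 y, adj x y & d y < d x.
Proof.
move=> /andP[_ /forallP/(_ r)/forallP Gc].
pose walk x k := [exists p : k.-tuple G, path (@adj G) r p && (last r p == x)].
have walkP x p : path (@adj G) r p -> last r p = x -> walk x (size p).
  by move=> rp <-; apply/existsP; exists (in_tuple p); rewrite rp eqxx.
have walk_ex x : exists k, walk x k.
  by have /connectP[p rp xE] := Gc x; exists (size p); exact: walkP.
exists (fun x => ex_minn (walk_ex x)) => x xr.
case: (ex_minnP (walk_ex x)) => k /existsP[[p /= /eqP <-]] /andP[rp /eqP xE] _.
case/lastP: p rp xE => [_ /= rx|p z]; first by rewrite rx eqxx in xr.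
rewrite rcons_path last_rcons size_rcons => /andP[rp pz] zx.
exists (last r p); first by rewrite adj_sym -zx.
by case: ex_minnP => m _; rewrite ltnS; apply; exact: walkP.
Qed.

Lemma card_tree_edges (G : sgraph) : is_tree G -> #|edge G| = #|G| - 1.
Proof.
move=> [Gc acG]; have /andP[/card_gt0P[r _] _] := Gc.
have [d dP] := connected_rank _ r Gc.
(* The default [x] can be reached only at the root [r]. *)
pose parent x := odflt x [pick y | adj x y && (d y < d x)].
have parentP x : x != r -> adj x (parent x) && (d (parent x) < d x).
  move=> /dP[y xy yx]; rewrite /parent.
  by case: pickP => [//|/(_ y)]; rewrite xy yx.
pose up x := [set x; parent x].
pose F := [set e : edge G | sval e \in up @: [set~ r]].
have Fup x : x != r -> span_adj F x (parent x).
  move=> xr; have /andP[xp _] := parentP _ xr.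
  have xpG : up x \in edge_set G by rewrite edge_setE.
  apply/existsP; exists (Sub (up x) xpG); rewrite inE /= eqxx andbT.
  by apply: imset_f; rewrite !inE.
have Froot x : connect (span_adj F) x r.
  elim: {x}_.+1 {-2}x (ltnSn (d x)) => // k IHk x xk.
  have [->|xr] := eqVneq x r; first exact: connect0.
  apply: connect_trans (connect1 (Fup _ xr)) _; apply: IHk.
  by have /andP[_ px] := parentP _ xr; exact: leq_trans px _.
have FT : F = [set: edge G].
  apply: acyclic_connected_spanT => //; apply/andP; split.
    by apply/card_gt0P; exists r.
  apply/forallP => x; apply/forallP => y; apply: connect_trans (Froot x) _.
  by rewrite (sym_connect_sym (@span_adj_sym _ F)).
(* Two distinct vertices with the same edge would be each other's parent, so [d] would strictly
   decrease in both directions. *)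
have up_inj : {in [set~ r] &, injective up}.
  move=> x y; rewrite !inE => xr yr xyE; apply/eqP/negPn/negP => nxy.
  have /andP[_ px] := parentP _ xr; have /andP[_ py] := parentP _ yr.
  have := set21 x (parent x); rewrite -/(up x) xyE !inE (negbTE nxy) /=.
  move/eqP=> xE; have := set21 y (parent y).
  rewrite -/(up y) -xyE !inE eq_sym (negbTE nxy) /= => /eqP yE.
  by move: px py; rewrite -xE -yE => yx /(ltn_trans yx); rewrite ltnn.
(* Edges are now counted as vertex sets: those underlying [F] are exactly the values of [up] off the
   root. *)
rewrite -cardsT -FT -(card_imset _ val_inj) subn1 -(cardsC1 r).
rewrite -(card_in_imset up_inj); congr #|pred_of_set _|.
apply/setP => A; apply/imsetP/idP => [[e]|Aup]; first by rewrite inE => ? ->.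
have AG : A \in edge_set G.
  case/imsetP: Aup => x; rewrite !inE => xr ->.
  by rewrite edge_setE; case/andP: (parentP _ xr).
by exists (Sub A AG); rewrite ?inE.
Qed.

Lemma acyclic_color_connectingT (G : ecgraph) (W : {set edge G}) :
  acyclic G -> 1 < #|color G| -> color_connecting W -> W = [set: edge G].
Proof.
move=> acG /card_gt1P[a [b [_ _ ab]]] /forallP Wc.
have colW c : W :|: color_class c = [set: edge G].
  exact: acyclic_connected_spanT (Wc c).
apply/setP => e; rewrite [RHS]inE.
have := in_setT e; have := in_setT e; rewrite -{1}(colW a) -(colW b) !inE.
(* An edge outside [W] would have both colors [a] and [b]. *)
case: (e \in W) => //= /eqP -> ba.
by rewrite ba in ab.
Qed.

Theorem corollary3p2 (T : ecgraph) (n l : nat)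
    (hT : is_tree T) (hn : #|T| = n) (hl : #|color T| = l) (hl2 : 2 <= l) :
  wld T = n - 1.
Proof.
have [[W Wc <-] _] := wldP T.
rewrite (acyclic_color_connectingT _ _ hT.2 _ Wc) ?hl //.
by rewrite cardsT card_tree_edges // hn.
Qed.
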